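(* Let $0\le\ell<u$, $1<p\le2$, $n\ge2$, and for $\ell<\xi_1<\cdots<\xi_{n-1}<u$ write $\boldsymbol\xi:=(\ell,\xi_1,\ldots,\xi_{n-1},u)$. Then $\operatorname{vol}(\breve{U}^*_p(\boldsymbol\xi))$ is strictly convex in $(\xi_1,\ldots,\xi_{n-1})$ (on the set $\ell<\xi_1<\cdots<\xi_{n-1}<u$).
   Context: Let $f(x):=x^p$ on $[\ell,u]$. Write $\xi_0:=\ell$, $\xi_n:=u$, put $\tau_0:=\ell$, $\tau_{n+1}:=u$ and, for $i=1,\ldots,n$, $$\tau_i:=\frac{[f(\xi_i)-f'(\xi_i)\xi_i]-[f(\xi_{i-1})-f'(\xi_{i-1})\xi_{i-1}]}{f'(\xi_{i-1})-f'(\xi_i)},$$ the abscissa of the intersection of the tangent lines to $f$ at $\xi_{i-1}$ and $\xi_i$. Let $g:[\ell,u]\to\mathbb{R}$ be the piecewise-linear function whose graph connects, in order, $(\ell,f(\ell))$, the points $(\tau_i,\ f(\xi_i)+f'(\xi_i)(\tau_i-\xi_i))$ for $i=1,\ldots,n$, and $(u,f(u))$. With $s:=\frac{f(u)-f(\ell)}{u-\ell}$, the set $\breve{U}^*_p(\boldsymbol\xi)$ is the closure of the convex hull of $$\left\{(x,y,z)\in\mathbb{R}^3:\ (f(\ell)-s\ell)z+sx\ge y\ge z\,g(x/z),\ uz\ge x\ge \ell z,\ 1\ge z>0,\ y\ge 0\right\}.$$ $\operatorname{vol}$ denotes 3-dimensional volume. *)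

(* Defs.v *)
From HB Require Import structures.
From mathcomp Require Import all_boot all_order all_algebra.
From mathcomp Require Import all_classical all_reals all_analysis.
From mathcomp Require Import lra.

Set Implicit Arguments.
Unset Strict Implicit.
Unset Printing Implicit Defensive.

Import Order.TTheory GRing.Theory Num.Theory.
Import numFieldNormedType.Exports.

Local Open Scope classical_set_scope.
Local Open Scope ring_scope.

(* One-sided at the endpoints when D is an interval: (powR ^~ p) is not
   differentiable at 0 as a function on the whole line, because `powR` takes
   the junk value 1 at negative numbers. *)
Definition derive_within (R : realType) (D : set R) (f : R -> R) (x : R) : R :=
  lim ((fun y => (f y - f x) / (y - x)) @ within D x^').

Lemma within_itv_proper (R : realType) (l u x : R) : l < u -> l <= x <= u ->
  ProperFilter (within `[l, u] x^').
Proof.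
move=> lu /andP[lx xu]; apply: Build_ProperFilter_ex.
move=> P; rewrite /within/=/dnbhs => -[e /= e0 H].
pose d := Num.min (e / 2) ((u - l) / 2).
have d0 : 0 < d by rewrite lt_min; apply/andP; split; lra.
have de : d <= e / 2 by rewrite ge_min lexx.
have du : d <= (u - l) / 2 by rewrite ge_min lexx orbT.
have [xl|xl] := leP x ((l + u) / 2).
  exists (x + d); apply: H => /=.
  - by rewrite opprD addNKr normrN gtr0_norm//; lra.
  - by rewrite gt_eqF//; lra.
  - by rewrite in_itv/=; apply/andP; split; lra.
exists (x - d); apply: H => /=.
- by rewrite opprB addrCA subrr addr0 gtr0_norm//; lra.
- by rewrite lt_eqF//; lra.
- by rewrite in_itv/=; apply/andP; split; lra.
Qed.

Lemma derive_within_powR (R : realType) (p l u x : R) :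
  0 <= l -> l < u -> 1 < p -> l <= x <= u ->
  derive_within `[l, u] (fun y => y `^ p) x = p * x `^ (p - 1).
Proof.
move=> l0 lu p1 lxu; have PF := within_itv_proper lu lxu.
apply: cvg_lim => //.
have [x0|x0] := ltP 0 x.
  apply: cvg_within_filter.
  have [dx <-] := is_derive1_powR p x0.
  move: dx => /cvgrPdist_lt dx; apply/cvgrPdist_lt => e /dx.
  rewrite /dnbhs/within/= => -[d /= d0 H]; exists d => //= y xy yx.
  have /= := H (y - x); rewrite sub0r opprB => /(_ xy).
  rewrite subr_eq0 => /(_ yx).
  rewrite [X in X + x](_ : _ = y - x); last exact: mulr1.
  by rewrite subrK [_ *: _]mulrC.
have : x = 0 by apply/eqP; rewrite eq_le x0 (le_trans l0)//; case/andP: lxu.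
move=> x_eq0; move: PF; rewrite x_eq0 => PF.
rewrite [0 `^ (p - 1)]powR0 ?gt_eqF ?subr_gt0// mulr0.
have p10 : 0 < p - 1 by rewrite subr_gt0.
have /cvgrPdist_lt C := powR_cvg0 p10.
apply/cvgrPdist_lt => e /C [d /= d0 H]; exists d => //= y xy y0.
rewrite in_itv/= => /andP[ly yu].
have yp : 0 < y by rewrite lt_neqAle eq_sym y0 (le_trans l0 ly).
have := H y xy yp.
rewrite powR0 ?subr0 ?gt_eqF ?(lt_trans ltr01 p1)//.
by rewrite powRB ?powRr1 ?ltW// gt_eqF ?implybT.
Qed.

Definition conv_hull (R : realType) (E : lmodType R) (A : set E) : set E :=
  smallest (@convex_set R E) A.

Definition vol3 (R : realType) : set (R * R * R) -> \bar R :=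
  ((@lebesgue_measure R \x @lebesgue_measure R) \x @lebesgue_measure R)%E.

(* `f` may take infinite values; the strict inequality forces `f` to be finite
   at every point strictly between two points of D. *)
Definition strictly_convex_on (R : realType) (E : lmodType R) (D : set E)
    (f : E -> \bar R) : Prop :=
  forall (x y : E) (t : R), D x -> D y -> x != y -> 0 < t < 1 ->
    (f (t *: x + (1 - t) *: y)%R < t%:E * f x + (1 - t)%:E * f y)%E.

(* The function whose graph joins consecutive points of the list, for a list
   sorted by strictly increasing abscissa. *)
Fixpoint pl_interp (R : realType) (pts : seq (R * R)) (x : R) : R :=
  if pts is P :: pts' then
    if pts' is Q :: _ then
      if x <= Q.1 then P.2 + (Q.2 - P.2) / (Q.1 - P.1) * (x - P.1)
      else pl_interp pts' x
    else P.2
  else 0.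

(* The list xi_0 = l, xi_1, ..., xi_{n-1}, xi_n = u; the row vector stores
   xi_i at index i - 1. *)
Definition knots (R : realType) (l u : R) (n : nat) (v : 'rV[R]_n.-1) : seq R :=
  l :: rcons [seq v 0 j | j <- enum 'I_n.-1] u.

Definition knot_domain (R : realType) (l u : R) (n : nat) : set 'rV[R]_n.-1 :=
  [set v | sorted <%R (knots l u v)].

Section PiecewiseLinearRelaxation.
Context {R : realType}.
Variables (p l u : R) (n : nat) (v : 'rV[R]_n.-1).

Let f : R -> R := fun x => x `^ p.
Let f' : R -> R := derive_within `[l, u] f.
Let xi (i : nat) : R := (knots l u v)`_i.

(* Only used for 1 <= i <= n. *)
Definition tangent_abscissa (i : nat) : R :=
  ((f (xi i) - f' (xi i) * xi i) - (f (xi i.-1) - f' (xi i.-1) * xi i.-1))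
    / (f' (xi i.-1) - f' (xi i)).

Let tau := tangent_abscissa.

Definition pl_vertices : seq (R * R) :=
  (l, f l)
    :: rcons [seq (tau i, f (xi i) + f' (xi i) * (tau i - xi i)) | i <- iota 1 n]
             (u, f u).

Definition pl_under : R -> R := pl_interp pl_vertices.

Definition secant_slope : R := (f u - f l) / (u - l).

Definition U_generators : set (R * R * R) :=
  [set q | let: (x, y, z) := q in
     [/\ y <= (f l - secant_slope * l) * z + secant_slope * x,
         z * pl_under (x / z) <= y,
         l * z <= x <= u * z,
         0 < z <= 1 &
         0 <= y]].

Definition U_breve : set (R * R * R) := closure (conv_hull U_generators).

End PiecewiseLinearRelaxation.

(* Main.v *)
Require Import Defs.
From HB Require Import structures.
From mathcomp Require Import all_boot all_order all_algebra.
From mathcomp Require Import all_classical all_reals all_analysis.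
From mathcomp Require Import measurable_realfun.
From mathcomp Require Import lra ring.
Import Order.TTheory GRing.Theory Num.Theory.
Import numFieldNormedType.Exports.

Set Implicit Arguments.
Unset Strict Implicit.
Unset Printing Implicit Defensive.

Local Open Scope classical_set_scope.
Local Open Scope ring_scope.

(** The set is a pyramid of height 1 whose apex is the origin and whose base is
    the planar region between the secant of [f] and the upper envelope of its
    tangents at the knots ([U_breveE]); its volume is one third of the area of
    that region ([volume_pyramid]). Up to a constant, the area is the sum, over
    consecutive knots [a < b], of the area between [f] and the tangents at [a]
    and [b], the first one being used up to their crossing and the second one
    after it ([volume_U_breve]).

    Using the tangents with another break point [x] instead of the crossing only
    enlarges that area ([piece_defect_crossing_min]). Hence the area is a minimum
    over break points of a function of both knots and break points, and partial
    minimization preserves convexity: it is enough that this function be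
    jointly convex. It is a sum of
    integrals of [f - T] from a knot [a], where [T] is tangent to [f], to a break
    point [x], or from the break point to the next knot. By Taylor's formula with
    integral remainder, setting [h = x - a],
[[
      int_a^x (f - T) = p (p - 1) / 2 * int_0^1 (1 - s)^2 h^3 (a + s h)^(p - 2) ds
]]
    where [h] and [a + s h] are linear in [(a, x)]. The function [X^3 Y^(-r)] is
    jointly convex for [0 <= r < 1] by Bernoulli's inequality and the inequality
    of arithmetic and geometric means ([cube_over_power_convex]); with
    [r = 2 - p] this gives [tangent_defect_convex].

    Convexity is strict in the variable [X], that is, as soon as some distance
    from a knot to a neighbouring crossing changes. If none of these
    distances changes then no knot does, the first one being fixed at [l]. *)

(** * Joint convexity of [x^3 y^(-r)] *)

Section PowerConvexity.
Context {R : realType}.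
Implicit Types (a b r t x y z p : R).

Lemma powR_bernoulli r y : 0 <= r < 1 -> 0 < y -> y `^ r <= 1 + r * (y - 1).
Proof.
case/andP; rewrite le_eqVlt => /predU1P[<- _ _|r0 r1 y0].
  by rewrite powRr0 mul0r addr0.
have r'0 : 0 < 1 - r by rewrite subr_gt0.
have := @conjugate_powR R (y `^ r) 1 r^-1 (1 - r)^-1 (powR_ge0 _ _) ler01.
rewrite !invr_gt0 !invrK subrKC => /(_ r0 r'0 erefl).
rewrite -powRrM mulfV ?gt_eqF// (powRr1 (ltW y0)) powR1 mulr1 mul1r.
by move=> /le_trans; apply; lra.
Qed.

(** Seen as a quadratic in [m], the difference of the two sides has discriminant
    [(1 - x)^2 (1 - 4 x)], which is negative for [x > 1/4] except for a double
    root at [x = 1]; for [x <= 1/3] no coefficient is negative. *)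
Lemma lteif_amgm3 x m : 0 < x -> 0 < m ->
  3 * x * m < x ^+ 3 + m ^+ 2 + m ?<= if (x == 1).
Proof.
move=> x0 m0; have [->|x1] /= := eqVneq x 1.
  have := sqr_ge0 (m - 1); lra.
have [xl|xg] := leP x 3^-1.
  have x30 : 0 < x ^+ 3 by rewrite exprn_gt0.
  by nra.
have : 0 < (1 - x) ^+ 2 * (4 * x - 1).
  rewrite mulr_gt0//; last by lra.
  by rewrite exprn_even_gt0//= subr_eq0 eq_sym.
have := sqr_ge0 (2 * m + 1 - 3 * x).
by nra.
Qed.

(** The right-hand side dominates its tangent plane at [(1, 1)]: Bernoulli
    replaces [y `^ r] by the affine [m], and multiplying by [m] leaves
    [lteif_amgm3]. *)
Lemma cube_over_power_tangent r x y : 0 <= r < 1 -> 0 < x -> 0 < y ->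
  3 * x - r * y - (2 - r) < x ^+ 3 * y `^ (- r) ?<= if (x == 1).
Proof.
move=> r01 x0 y0; have /andP[r0 r1] := r01.
pose m := 1 + r * (y - 1).
have m0 : 0 < m by rewrite /m; nra.
have ym : m^-1 <= y `^ (- r).
  by rewrite powRN lef_pV2 ?posrE ?powR_gt0// powR_bernoulli.
suff lower : 3 * x - r * y - (2 - r) < x ^+ 3 * m^-1 ?<= if (x == 1).
  have := @lteif_trans _ _ _ _ _ _ true lower; rewrite andbT; apply.
  by rewrite /= ler_wpM2l// exprn_ge0// ltW.
rewrite lteif_pdivlMr// -(lteifD2r _ (m ^+ 2 + m)).
have := lteif_amgm3 x0 m0; congr (_ < _ ?<= if _); last by ring.
by rewrite /m; ring.
Qed.

(** The function [x^3 y^(-r)] is homogeneous under independent rescalings of [x]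
    and [y], so its tangent plane at any point is the one of
    [cube_over_power_tangent] rescaled; averaging the tangent inequalities at
    the intermediate point gives joint convexity. Strictness can only come from
    [x] when [r = 0], as the function then does not depend on [y]. *)
Lemma cube_over_power_convex r t x0 x1 y0 y1 : 0 <= r < 1 -> 0 < t < 1 ->
  0 < x0 -> 0 < x1 -> 0 < y0 -> 0 < y1 ->
  (t * x0 + (1 - t) * x1) ^+ 3 * (t * y0 + (1 - t) * y1) `^ (- r)
  < t * (x0 ^+ 3 * y0 `^ (- r)) + (1 - t) * (x1 ^+ 3 * y1 `^ (- r))
  ?<= if (x0 == x1).
Proof.
move=> r01 /andP[t0 t1] x00 x10 y00 y10.
have affine_avg (M u v : R) : M * (3 * ((t * x0 + (1 - t) * x1) * u)
      - r * ((t * y0 + (1 - t) * y1) * v) - (2 - r)) =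
    t * (M * (3 * (x0 * u) - r * (y0 * v) - (2 - r)))
    + (1 - t) * (M * (3 * (x1 * u) - r * (y1 * v) - (2 - r))) by ring.
set xm := t * x0 + _; set ym := t * y0 + _.
have t'0 : 0 < 1 - t by rewrite subr_gt0.
have xm0 : 0 < xm by rewrite addr_gt0// mulr_gt0.
have ym0 : 0 < ym by rewrite addr_gt0// mulr_gt0.
have tangent x y : 0 < x -> 0 < y ->
    (xm ^+ 3 * ym `^ (- r)) * (3 * (x / xm) - r * (y / ym) - (2 - r))
    < x ^+ 3 * y `^ (- r) ?<= if (x == xm).
  move=> x_gt0 y_gt0.
  have xxm : 0 < x / xm by rewrite divr_gt0.
  have yym : 0 < y / ym by rewrite divr_gt0.
  have := cube_over_power_tangent r01 xxm yym.
  have m0 : 0 < xm ^+ 3 * ym `^ (- r) by rewrite mulr_gt0 ?exprn_gt0 ?powR_gt0.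
  rewrite -(lteif_pM2l _ m0); congr (_ < _ ?<= if _); last first.
    rewrite -[1](divff (lt0r_neq0 xm0)) (inj_eq (mulIf _))//.
    by rewrite invr_eq0 gt_eqF.
  rewrite mulrACA -exprMn -powRM ?ltW//.
  by rewrite ![_ * (_ / _)]mulrC !divfK ?gt_eqF.
have h0 := tangent _ _ x00 y00; have h1 := tangent _ _ x10 y10.
move: h0 h1; rewrite -(lteif_pM2l _ t0) -(lteif_pM2l (x1 == xm) t'0).
set M := xm ^+ 3 * _.
set q0 := x0 ^+ 3 * _; set q1 := x1 ^+ 3 * _ => h0 h1.
have -> : M = t * (M * (3 * (x0 / xm) - r * (y0 / ym) - (2 - r)))
         + (1 - t) * (M * (3 * (x1 / xm) - r * (y1 / ym) - (2 - r))).
  rewrite /=; transitivity (M * (3 * (xm / xm) - r * (ym / ym) - (2 - r))).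
    by rewrite !mulfV ?gt_eqF//; ring.
  exact: affine_avg.
have [x01|x01] /= := eqVneq x0 x1.
  by apply: lerD; apply: lteifW; [exact: h0|exact: h1].
apply: ltr_leD; last exact: lteifW h1.
move: h0; have -> // : x0 == xm = false.
apply: contra_neqF x01 => /eqP x0m.
have : (1 - t) * (x0 - x1) = x0 - xm by rewrite /xm; ring.
rewrite -x0m subrr.
by move/eqP; rewrite mulf_eq0 gt_eqF//= subr_eq0 => /eqP.
Qed.
End PowerConvexity.

(** * The area between a power function and its tangent *)

Section TangentDefect.
Context {R : realType}.
Implicit Types (a h q t x y z p : R).

(** The integral from [a] to [x] of [f - T], where [f] is the power function and
    [T] its tangent at [a]. *)
Definition tangent_defect p a x : R :=
  x `^ (p + 1) / (p + 1) - a `^ (p + 1) / (p + 1) - a `^ p * (x - a)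
  - p * a `^ (p - 1) * (x - a) ^+ 2 / 2.

(** Taylor's polynomial of order two of a primitive of [f], expanded at
    [a + s h] and evaluated at [a + h]. Its increment over [0 <= s <= 1] is the
    remainder, that is, the tangent defect; differentiating in [s] gives
    the integrand of the integral form of that remainder. *)
Definition taylor_path p a h (s : R) : R :=
  (a + s * h) `^ (p + 1) / (p + 1) + (1 - s) * h * (a + s * h) `^ p
  + (1 - s) ^+ 2 * h ^+ 2 / 2 * (p * (a + s * h) `^ (p - 1)).

Lemma tangent_defectE p a x :
  tangent_defect p a x = taylor_path p a (x - a) 1 - taylor_path p a (x - a) 0.
Proof.
rewrite /taylor_path /tangent_defect mul1r subrKC mul0r addr0 subrr subr0; ring.
Qed.

Lemma affine_gt0 a h (s : R) : 0 <= a -> 0 < a + h -> 0 < s <= 1 -> 0 < a + s * h.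
Proof. by move=> a0 ah /andP[s0 s1]; nra. Qed.

Lemma is_derive_powR_affine q a h (s : R) : 0 < a + s * h ->
  is_derive s 1 (fun s => (a + s * h) `^ q) (h * (q * (a + s * h) `^ (q - 1))).
Proof.
move=> ash.
have d1 : is_derive s 1 (fun s : R => a + s * h) h.
  apply: is_derive_eq; rewrite /GRing.scale/=; ring.
have := @is_derive1_comp R (@powR R ^~ q) (fun s : R => a + s * h) s _ _
  (is_derive1_powR q ash) d1.
by rewrite mulrC.
Qed.

Lemma is_derive_taylor_path p a h (s : R) : 0 < p + 1 -> 0 < a + s * h ->
  is_derive s 1 (taylor_path p a h)
    (p * (p - 1) / 2 * (1 - s) ^+ 2 * (h ^+ 3 * (a + s * h) `^ (p - 2))).
Proof.
move=> p0 ash.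
have d1 := @is_derive_powR_affine (p + 1) _ _ _ ash.
have d2 := @is_derive_powR_affine p _ _ _ ash.
have d3 := @is_derive_powR_affine (p - 1) _ _ _ ash.
rewrite /taylor_path; apply: is_derive_eq.
rewrite /GRing.scale/=.
have e1 : p + 1 - 1 = p by ring. have e2 : p - 1 - 1 = p - 2 by ring.
rewrite e1 e2; field.
by rewrite gt_eqF.
Qed.

(** When [a = 0] the base of the power vanishes in the limit, and convergence only
    holds from the right because [powR] takes the value 1 at negative bases. *)
Lemma cvg_powR_affine q a h : 0 < q -> 0 <= a -> 0 < a + h ->
  (a + s * h) `^ q @[s --> 0^'+] --> a `^ q.
Proof.
move=> q0; rewrite le_eqVlt => /predU1P[<-|a0] ah.
  rewrite add0r in ah.
  rewrite powR0 ?gt_eqF//.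
  apply: (@cvg_trans _ (s `^ q * h `^ q @[s --> 0^'+])).
    apply: near_eq_cvg; near=> s.
    by rewrite add0r powRM ?ltW.
  have : s `^ q * h `^ q @[s --> 0^'+] --> 0 * h `^ q.
    by apply: cvgMr_tmp; exact: powR_cvg0.
  by rewrite mul0r.
apply: cvg_at_right_filter.
have a00 : 0 < a + 0 * h by rewrite mul0r addr0.
have [d _] := @is_derive_powR_affine q a h 0 a00.
have : (a + s * h) `^ q @[s --> (0 : R)] --> (a + 0 * h) `^ q.
  exact: differentiable_continuous ((derivable1_diffP _ _).1 d).
by rewrite mul0r addr0.
Unshelve. all: by end_near. Qed.

Lemma continuous_taylor_path p a h : 1 < p -> 0 <= a -> 0 < a + h ->
  {within `[0, 1], continuous (taylor_path p a h)}.
Proof.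
move=> p1 a0 ah.
have cont (s : R) : 0 < s <= 1 -> {for s, continuous (taylor_path p a h)}.
  move=> s01; have ash := affine_gt0 a0 ah s01.
  have p10 : 0 < p + 1 by lra.
  have [d _] := is_derive_taylor_path p10 ash.
  exact: differentiable_continuous ((derivable1_diffP _ _).1 d).
apply/continuous_within_itvP => //; split.
- by move=> s; rewrite in_itv/= => /andP[s0 s1]; apply: cont; rewrite s0 ltW.
- have cvg_s : (s : R) @[s --> (0:R)^'+] --> (0 : R) by exact: cvg_at_right_filter.
  have cvg_pow q : 0 < q ->
      (a + s * h) `^ q @[s --> (0:R)^'+] --> (a + 0 * h) `^ q.
    by move=> q0; rewrite mul0r addr0; exact: cvg_powR_affine.
  have pp : 0 < p + 1 by lra. have pm : 0 < p - 1 by lra. have pz : 0 < p by lra.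
  have c1s : (1 - s : R) @[s --> (0:R)^'+] --> (1 - 0 : R).
    by apply: cvgB => //; exact: cvg_cst.
  rewrite /taylor_path; apply: cvgD; first apply: cvgD.
  + by apply: cvgMr_tmp; exact: cvg_pow.
  + apply: cvgM; last exact: cvg_pow.
    by apply: cvgMr_tmp.
  + apply: cvgM; last by apply: cvgMl_tmp; exact: cvg_pow.
    by do 2 apply: cvgMr_tmp; apply: cvgM.
- by apply: cvg_at_left_filter; apply: cont; rewrite ltr01 lexx.
Qed.

(** With [h = x - a], the defect is the integral over [0 <= s <= 1] of a positive
    multiple of [h^3 (a + s h)^(p - 2)], in which [h] and [a + s h] are
    linear in [(a, x)], so joint convexity follows from
    [cube_over_power_convex] with exponent [2 - p]. The mean value theorem
    applied to the convexity gap along [taylor_path] replaces the integral.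
    The factor [s] is a sign: the defect is convex for [x > a] ([s = 1]) and
    concave for [x < a] ([s = -1]). *)
Lemma tangent_defect_convex p s t a0 x0 a1 x1 :
  1 < p <= 2 -> 0 < t < 1 -> 0 <= a0 -> 0 <= a1 -> 0 < x0 -> 0 < x1 ->
  0 < s * (x0 - a0) -> 0 < s * (x1 - a1) ->
  s ^+ 3 * tangent_defect p (t * a0 + (1 - t) * a1) (t * x0 + (1 - t) * x1)
  < s ^+ 3 * (t * tangent_defect p a0 x0 + (1 - t) * tangent_defect p a1 x1)
  ?<= if (x0 - a0 == x1 - a1).
Proof.
move=> /andP[p1 p2] t01 a00 a10 x00 x10 h00 h10.
have /andP[t0 t1] := t01; have t'0 : 0 < 1 - t by lra.
have r01 : 0 <= 2 - p < 1 by apply/andP; split; lra.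
rewrite !tangent_defectE; set am := t * a0 + _; set xm := t * x0 + _.
set h0 := x0 - a0 in h00 *; set h1 := x1 - a1 in h10 *; set hm := xm - am.
have hmE : hm = t * h0 + (1 - t) * h1 by rewrite /hm /h0 /h1 /xm /am; ring.
have am0 : 0 <= am by rewrite addr_ge0// mulr_ge0// ltW.
have xm0 : 0 < xm by rewrite addr_gt0// mulr_gt0.
have ah0 : 0 < a0 + h0 by rewrite subrKC.
have ah1 : 0 < a1 + h1 by rewrite subrKC.
have ahm : 0 < am + hm by rewrite subrKC.
pose gap := fun c : R => s ^+ 3 * (t * taylor_path p a0 h0 c
  + (1 - t) * taylor_path p a1 h1 c - taylor_path p am hm c).
pose coef c := p * (p - 1) / 2 * (1 - c) ^+ 2.
pose dgap c := coef c * (t * ((s * h0) ^+ 3 * (a0 + c * h0) `^ (p - 2))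
  + (1 - t) * ((s * h1) ^+ 3 * (a1 + c * h1) `^ (p - 2))
  - (s * hm) ^+ 3 * (am + c * hm) `^ (p - 2)).
have pp : 0 < p + 1 by lra.
have dgapP (c : R) : c \in `]0, 1[ -> is_derive c 1 gap (dgap c).
  rewrite in_itv/= => /andP[c0 c1]; have c01 : 0 < c <= 1 by rewrite c0 ltW.
  have d0 := is_derive_taylor_path pp (affine_gt0 a00 ah0 c01).
  have d1 := is_derive_taylor_path pp (affine_gt0 a10 ah1 c01).
  have dm := is_derive_taylor_path pp (affine_gt0 am0 ahm c01).
  rewrite /gap; apply: is_derive_eq.
  by rewrite /dgap /coef /GRing.scale/=; ring.
have cgap : {within `[0, 1], continuous gap}.
  have C0 := continuous_taylor_path p1 a00 ah0.
  have C1 := continuous_taylor_path p1 a10 ah1.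
  have Cm := continuous_taylor_path p1 am0 ahm.
  rewrite /gap => z.
  apply: cvgMl_tmp; apply: cvgB; last exact: Cm.
  by apply: cvgD; apply: cvgMl_tmp; [exact: C0|exact: C1].
have [c c01 gapE] := MVT ltr01 dgapP cgap.
(* The sign [s] makes the cubed quantities positive, whence its cube in [gap]. *)
have : 0 < dgap c ?<= if (h0 == h1).
  move: c01; rewrite in_itv/= => /andP[c0 c1].
  have c01 : 0 < c <= 1 by rewrite c0 ltW.
  have k0 : 0 < coef c by rewrite !mulr_gt0 ?invr_gt0 ?exprn_gt0//; lra.
  rewrite /dgap -[0](mulr0 (coef c)) lteif_pM2l// subr_lteif0r.
  have s0 : s != 0 by apply: contraTneq h00 => ->; rewrite mul0r ltxx.
  have := cube_over_power_convex r01 t01 h00 h10 (affine_gt0 a00 ah0 c01)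
    (affine_gt0 a10 ah1 c01).
  rewrite opprB (inj_eq (mulfI s0)); congr (_ * _ `^ _ < _ ?<= if _).
    by rewrite hmE; ring.
  by rewrite /am hmE; ring.
have -> : dgap c = gap 1 - gap 0 by rewrite gapE subr0 mulr1.
move=> gap_gt0; rewrite -subr_lteif0r.
move: gap_gt0; congr (_ < _ ?<= if _).
by rewrite /gap; ring.
Qed.
End TangentDefect.

(** * Integrals over segments and Cavalieri's principle *)

Lemma product_measure_cavalieri d1 d2 (T1 : measurableType d1) (T2 : measurableType d2)
   (R : realType) (m1 : {sigma_finite_measure set T1 -> \bar R})
  (m2 : {sigma_finite_measure set T2 -> \bar R}) (X : set (T1 * T2)) :
  measurable X -> ((m1 \x m2) X = \int[m2]_y m1 (ysection X y))%E.
Proof.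
move=> mX.
rewrite (product_measure_unique (m' := (m1 \x^ m2)%E))//.
by move=> A B mA mB; exact: product_measure2E.
Qed.

Section SegmentIntegrals.
Context {R : realType}.
Notation mu := (@lebesgue_measure R).

(** Unlike the fundamental theorem it rests on, this allows a degenerate segment,
    which occurs in the slice of a pyramid through its apex. *)
Lemma integral_derivative (f F : R -> R) (a b : R) : a <= b ->
  continuous f -> (forall x : R, is_derive x 1 F (f x)) ->
  (\int[mu]_(x in `[a, b]) (f x)%:E = (F b - F a)%:E)%E.
Proof.
rewrite le_eqVlt => /predU1P[<-|ab] cf dF.
  by rewrite set_itv1 integral_set1 subrr.
have cF (x : R) : {for x, continuous F}.
  have [d _] := dF x.
  exact: differentiable_continuous ((derivable1_diffP _ _).1 d).
rewrite (continuous_FTC2 ab (F := F)) ?EFinB//.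
- exact: continuous_subspaceT.
- split.
  + by move=> x _; have [] := dF x.
  + by apply: cvg_at_right_filter; exact: cF.
  + by apply: cvg_at_left_filter; exact: cF.
- by move=> x _; rewrite derive1E; have [_ ->] := dF x.
Qed.

Lemma integral_affine (c m a b : R) : a <= b ->
  (\int[mu]_(x in `[a, b]) (c + m * x)%:E
   = (c * (b - a) + m * (b ^+ 2 - a ^+ 2) / 2)%:E)%E.
Proof.
move=> ab; have cf : continuous (fun x : R => c + m * x).
  by move=> x; apply: cvgD; [exact: cvg_cst|exact: cvgMl_tmp].
have dF (x : R) : is_derive x 1 (fun x => c * x + m * x ^+ 2 / 2) (c + m * x).
  by apply: is_derive_eq; rewrite /GRing.scale/=; field.
by rewrite (integral_derivative ab cf dF); congr EFin; ring.
Qed.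

Lemma integral_square (c : R) :
  (\int[mu]_(x in `[0%R, 1%R]) (c * x ^+ 2)%:E = (c / 3)%:E)%E.
Proof.
have cf : continuous (fun x : R => c * x ^+ 2).
  by move=> x; apply: cvgMl_tmp; exact: exprn_continuous.
have dF (x : R) : is_derive x 1 (fun x => c * x ^+ 3 / 3) (c * x ^+ 2).
  by apply: is_derive_eq; rewrite /GRing.scale/=; field.
by rewrite (integral_derivative ler01 cf dF); congr EFin; ring.
Qed.

Lemma integral_subdivision (h : R -> \bar R) (w : nat -> R) (k : nat) :
  measurable_fun [set: R] h -> (forall x, (0 <= h x)%E) ->
  (forall i, (i < k)%N -> w i <= w i.+1) ->
  (\int[mu]_(x in `[w 0%N, w k]) h x
   = \sum_(i < k) \int[mu]_(x in `[w i, w i.+1]) h x)%E.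
Proof.
move=> mh h0; elim: k => [|k IHk] wmono.
  by rewrite set_itv1 integral_set1 big_ord0.
rewrite big_ord_recr/= -IHk; last by move=> i ik; apply: wmono; rewrite ltnW.
have w0k : w 0%N <= w k.
  have /(_ k (leqnn k)) : forall i, (i <= k)%N -> w 0%N <= w i.
    by elim=> // i IHi ik; rewrite (le_trans (IHi (ltnW ik)))// wmono// ltnW.
  by [].
rewrite -(@integral_itv_obnd_cbnd _ (w k)); last exact: measurable_funTS.
rewrite -ge0_integral_setU//=.
- by rewrite -itv_bndbnd_setU// bnd_simp ?wmono.
- exact: measurable_funTS.
- by apply/disj_setPS => x /= []; rewrite !in_itv/= => /andP[_ +] /andP[]; case: ltgtP.
Qed.

(** Iterating [product_measure_cavalieri] in dimension three requires the
    sigma-finiteness of the planar measure: squares of side [2 k] exhaust the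
    plane. *)
Lemma sigma_finite_plane : sigma_finite setT (mu \x mu)%E.
Proof.
pose I (k : nat) : set R := `[- k%:R, k%:R]%classic.
have mI k : measurable (I k) by exact: measurable_itv.
exists (fun k => I k `*` I k).
  apply/esym; rewrite -subTset => -[x y] _.
  exists (maxn (Num.bound `|x|) (Num.bound `|y|)) => //.
  split; rewrite /I/= in_itv/= -ler_norml.
    by rewrite (le_trans (ltW (archi_boundP (normr_ge0 x))))// ler_nat leq_maxl.
  by rewrite (le_trans (ltW (archi_boundP (normr_ge0 y))))// ler_nat leq_maxr.
move=> k; split; first by apply: measurableX; exact: mI.
rewrite product_measure1E; [|exact: mI|exact: mI].
have finI : (mu (I k) < +oo)%E.
  by rewrite lebesgue_measure_itv/=; case: ifP => _; rewrite ?ltry// -EFinB ltry.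
by rewrite lte_mul_pinfty// ge0_fin_numE.
Qed.

Lemma volume_slices (P : set (R*R*R)): measurable P -> ((mu \x mu) \x mu)%E P = 
 (\int[mu]_z \int[mu]_x (mu (xsection (ysection P z) x)))%E.
Proof.
move=> mP. 
pose plane : {sigma_finite_measure set _ -> \bar R} :=
  HB.pack_for {sigma_finite_measure set _ -> \bar R} (mu \x mu)%E
    (@Measure_isSigmaFinite.Build _ _ R (mu \x mu)%E sigma_finite_plane).
exact: (@product_measure_cavalieri _ _ _ _ _ plane).
Qed.
End SegmentIntegrals.

(** * Volume of a pyramid over a polygonal region *)

Section PyramidVolume.
Context {R : realType}.
Notation mu := (@lebesgue_measure R).
Variables (n : nat) (w c m : nat -> R) (cU mU : R).

(** The cone with apex 0 over a polygonal region of the plane at height 1, cut at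
    that height: each inequality is the homogenization of one that defines the
    base. *)
Definition pyramid : set (R * R * R) :=
  [set q | [/\ 0 <= q.2 <= 1, w 0%N * q.2 <= q.1.1 <= w n.+1 * q.2,
     forall i, (i <= n)%N -> c i * q.2 + m i * q.1.1 <= q.1.2
   & q.1.2 <= cU * q.2 + mU * q.1.1]].

(** The area of the region at height 1, when the line of index [i] is the highest
    of the lower lines between [w i] and [w i.+1]. *)
Definition base_area : R :=
  \sum_(i < n.+1) ((cU - c i) * (w i.+1 - w i)
                   + (mU - m i) * (w i.+1 ^+ 2 - w i ^+ 2) / 2).

Hypothesis w_mono : forall i, (i <= n)%N -> w i <= w i.+1.
Hypothesis line_max : forall i j x, (i <= n)%N -> (j <= n)%N ->
  w i <= x <= w i.+1 -> c j + m j * x <= c i + m i * x.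
Hypothesis line_le_upper : forall i x, (i <= n)%N ->
  w i <= x <= w i.+1 -> c i + m i * x <= cU + mU * x.

(** Off the apex, divide by [z]; at the apex [z = 0] the constraint leaves only
    [x = 0], where both sides vanish. *)
Lemma homogenize_le a b a' b' i x z : 0 <= z -> w i * z <= x <= w i.+1 * z ->
  (forall x, w i <= x <= w i.+1 -> a + b * x <= a' + b' * x) ->
  a * z + b * x <= a' * z + b' * x.
Proof.
rewrite le_eqVlt => /predU1P[<-|z0]; rewrite ?mulr0.
  by rewrite -eq_le => /eqP <-; rewrite !mulr0.
rewrite -(ler_pdivlMr _ _ z0) -(ler_pdivrMr _ _ z0) => xz /(_ _ xz).
by rewrite -(ler_pM2r z0) !mulrDl -!mulrA mulVf ?gt_eqF// !mulr1.
Qed.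

Lemma measurable_pyramid : measurable pyramid.
Proof.
have mx : measurable_fun [set: R * R * R] (fun q : R * R * R => q.1.1).
  exact: measurableT_comp measurable_fst measurable_fst.
have my : measurable_fun [set: R * R * R] (fun q : R * R * R => q.1.2).
  exact: measurableT_comp measurable_snd measurable_fst.
have mz : measurable_fun [set: R * R * R] (fun q : R * R * R => q.2).
  exact: measurable_snd.
have mlin a b : measurable_fun [set: R * R * R] (fun q => a * q.2 + b * q.1.1).
  by apply: measurable_funD; apply: measurable_funM => //; exact: measurable_cst.
have mle (f g : R * R * R -> R) : measurable_fun setT f -> measurable_fun setT g ->
    measurable [set q | f q <= g q].
  by move=> mf mg; rewrite -[X in measurable X]setTI; exact: measurable_fun_le.
have mscale a : measurable_fun [set: R * R * R] (fun q => a * q.2).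
  by apply: measurable_funM => //; exact: measurable_cst.
have -> : pyramid =
    [set q | 0 <= q.2] `&` [set q | q.2 <= 1]
    `&` ([set q | w 0%N * q.2 <= q.1.1] `&` [set q | q.1.1 <= w n.+1 * q.2])
    `&` (\bigcap_(i in [set i | (i <= n)%N])
         [set q | c i * q.2 + m i * q.1.1 <= q.1.2])
    `&` [set q | q.1.2 <= cU * q.2 + mU * q.1.1].
  apply/seteqP; split=> q.
    by case=> /andP[? ?] /andP[? ?] lines ?; split.
  by case=> -[[[z0 z1] [x0 x1]] lines] y1; split => //=; apply/andP; split.
have mcst a : measurable_fun [set: R * R * R] (fun=> a : R).
  exact: measurable_cst.
apply: measurableI; last exact: mle.
apply: measurableI; last by apply: bigcap_measurableType => i _; exact: mle.
by apply: measurableI; apply: measurableI; exact: mle.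
Qed.

Lemma subdivision_le i j : (i <= j)%N -> (j <= n.+1)%N -> w i <= w j.
Proof.
elim: j => [|j IHj]; first by rewrite leqn0 => /eqP ->.
rewrite leq_eqVlt => /predU1P[-> //|]; rewrite ltnS => ij jn.
by rewrite (le_trans (IHj ij (ltnW jn)))// w_mono.
Qed.

Lemma pyramid_sectionsE z x y :
  xsection (ysection pyramid z) x y = pyramid (x, y, z).
Proof. by rewrite /xsection/= inE /ysection/= inE. Qed.

Lemma pyramid_section z x i : 0 <= z <= 1 -> (i <= n)%N ->
  w i * z <= x <= w i.+1 * z ->
  xsection (ysection pyramid z) x
  = `[c i * z + m i * x, cU * z + mU * x]%classic.
Proof.
move=> z01 ilen xi; have /andP[z0 _] := z01; have /andP[xil xir] := xi.
apply/seteqP; split=> y; rewrite pyramid_sectionsE /pyramid/= in_itv/=.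
  by case=> _ _ lines ->; rewrite lines.
move=> /andP[y0 y1]; split => //.
  rewrite (le_trans _ xil) ?(le_trans xir)//; apply: ler_wpM2r => //;
  by apply: subdivision_le => //; exact: leqW.
move=> j jn; apply: le_trans y0.
by apply: homogenize_le xi _ => // x'; exact: line_max.
Qed.

Lemma measure_pyramid_section z x i : 0 <= z <= 1 -> (i <= n)%N ->
  w i * z <= x <= w i.+1 * z ->
  mu (xsection (ysection pyramid z) x)
  = ((cU - c i) * z + (mU - m i) * x)%:E.
Proof.
move=> z01 ilen xi; have /andP[z0 _] := z01; rewrite (pyramid_section z01 ilen xi).
have : c i * z + m i * x <= cU * z + mU * x.
  by apply: homogenize_le xi _ => // x'; exact: line_le_upper.
rewrite lebesgue_measure_itv/= lte_fin le_eqVlt => /predU1P[e|->].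
  by rewrite e ltxx; congr EFin; lra.
by rewrite -EFinB; congr EFin; ring.
Qed.

Lemma measure_pyramid_slice z : 0 <= z <= 1 ->
  (\int[mu]_x mu (xsection (ysection pyramid z) x) = (base_area * z ^+ 2)%:E)%E.
Proof.
move=> z01; have /andP[z0 z1] := z01.
pose h x := mu (xsection (ysection pyramid z) x).
have mh : measurable_fun [set: R] h.
  apply: measurable_fun_xsection; apply: measurable_ysection.
  exact: measurable_pyramid.
pose wz i := w i * z.
have -> : (\int[mu]_x h x = \int[mu]_(x in `[wz 0%N, wz n.+1]) h x)%E.
  rewrite [RHS]integral_mkcond; apply: eq_integral => x _.
  rewrite patchE; case: ifPn => //; rewrite notin_setE/= in_itv/= => xout.
  rewrite /h (_ : xsection _ _ = set0) ?measure0// -subset0 => y.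
  by rewrite pyramid_sectionsE /pyramid/= => -[_ /xout].
rewrite integral_subdivision//; last by move=> i ilen; rewrite ler_wpM2r// w_mono.
rewrite /base_area mulr_suml -sumEFin; apply: eq_bigr => i _.
have ilen : (i <= n)%N by rewrite -ltnS.
have wi : wz i <= wz i.+1 by rewrite ler_wpM2r// w_mono.
transitivity (\int[mu]_(x in `[wz i, wz i.+1]) ((cU - c i) * z + (mU - m i) * x)%:E)%E.
  apply: eq_integral => x; rewrite inE/= in_itv/= => xi.
  exact: measure_pyramid_section.
by rewrite (integral_affine _ _ wi) /wz; congr EFin; ring.
Qed.

(** Cavalieri's principle: the slice at height [z] is the base scaled by [z], so
    its area is [z^2] times the area of the base. *)
Lemma volume_pyramid :
  ((mu \x mu) \x mu)%E pyramid = (base_area / 3)%:E.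
Proof.
rewrite volume_slices; last exact: measurable_pyramid.
rewrite -integral_square [RHS]integral_mkcond; apply: eq_integral => z _.
rewrite patchE; case: ifPn; first by rewrite inE/= in_itv/=; exact: measure_pyramid_slice.
rewrite notin_setE/= in_itv/= => zout.
apply: integral0_eq => x _.
rewrite (_ : xsection _ _ = set0) ?measure0// -subset0 => y.
by rewrite pyramid_sectionsE /pyramid/= => -[/zout].
Qed.
End PyramidVolume.

(** * Tangents to a power function *)

Section TangentLines.
Context {R : realType}.
Implicit Types (p a b x : R).

Lemma powR_mean_value p a b : 1 < p -> 0 < a -> a < b ->
  exists2 c, a < c < b & b `^ p - a `^ p = p * c `^ (p - 1) * (b - a).
Proof.
move=> p1 a0 ab.
have d (x : R) : 0 < x -> is_derive x 1 (@powR R ^~ p) (p * x `^ (p - 1)).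
  exact: is_derive1_powR.
have c : {within `[a, b], continuous (@powR R ^~ p)}.
  apply: derivable_within_continuous => x; rewrite in_itv/= => /andP[ax _].
  by have [] := d x (lt_le_trans a0 ax).
have [] := MVT ab (df := fun x => p * x `^ (p - 1)) _ c.
  by move=> x; rewrite in_itv/= => /andP[ax _]; apply: d; exact: lt_trans ax.
by move=> x; rewrite in_itv/= => axb e; exists x.
Qed.

(** Strict convexity of the power function, by the mean value theorem and the
    monotonicity of its derivative; 0 is treated apart, as [powR] is
    discontinuous there. *)
Lemma tangent_lt_powR p a b : 1 < p -> 0 <= a -> 0 <= b -> a != b ->
  a `^ p + p * a `^ (p - 1) * (b - a) < b `^ p.
Proof.
move=> p1; rewrite le_eqVlt => /predU1P[<-|a0].
  rewrite le_eqVlt => /predU1P[<-|b0 _]; first by rewrite eqxx.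
  rewrite !powR0 ?gt_eqF ?subr_gt0//; last by lra.
  by rewrite mulr0 mul0r addr0 powR_gt0.
rewrite le_eqVlt => /predU1P[<- _|b0 ab].
  rewrite sub0r mulrN -mulrA [_ * a]mulrC mulr_powRB1 ?ltW//; last by lra.
  rewrite powR0 ?gt_eqF//; last by lra.
  by have := powR_gt0 p a0; nra.
have mono x y : 0 < x -> x < y -> x `^ (p - 1) < y `^ (p - 1).
  move=> x0 xy.
  by rewrite gt0_ltr_powR ?subr_gt0 ?nnegrE ?ltW// (lt_trans x0).
move: ab; rewrite neq_lt => /orP[ab|ba].
  have [c /andP[ac cb] e] := powR_mean_value p1 a0 ab.
  have := mono _ _ a0 ac; move: e.
  move: (c `^ _) (a `^ (p - 1)) (a `^ p) (b `^ p) => C A fa fb e CA.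
  have : 0 < p * (C - A) * (b - a) by rewrite !mulr_gt0//; lra.
  by lra.
have [c /andP[bc ca] e] := powR_mean_value p1 b0 ba.
have := mono _ _ (lt_trans b0 bc) ca; move: e.
move: (c `^ _) (a `^ (p - 1)) (a `^ p) (b `^ p) => C A fa fb e CA.
have : 0 < p * (A - C) * (a - b) by rewrite !mulr_gt0//; lra.
by lra.
Qed.

Lemma slope_lt p a b : 1 < p -> 0 <= a -> a < b ->
  p * a `^ (p - 1) < p * b `^ (p - 1).
Proof.
move=> p1 a0 ab; rewrite ltr_pM2l; last by lra.
by rewrite gt0_ltr_powR ?subr_gt0 ?nnegrE// (le_trans a0)// ltW.
Qed.

Definition tangent_icept p a := a `^ p - p * a `^ (p - 1) * a.
Definition tangent_slope p a := p * a `^ (p - 1).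

(** The abscissa at which the tangents at [a] and [b] meet. *)
Definition tangent_cross p a b :=
  (tangent_icept p b - tangent_icept p a) / (tangent_slope p a - tangent_slope p b).

Lemma tangent_sub p a b x : 1 < p -> 0 <= a -> a < b ->
  (tangent_icept p a + tangent_slope p a * x)
  - (tangent_icept p b + tangent_slope p b * x)
  = (tangent_slope p b - tangent_slope p a) * (tangent_cross p a b - x).
Proof.
move=> p1 a0 ab; have := slope_lt p1 a0 ab.
rewrite /tangent_cross -/(tangent_slope p a) -/(tangent_slope p b).
move: (tangent_slope p a) (tangent_slope p b) (tangent_icept p a) (tangent_icept p b).
by move=> sa sb ca cb ssab; field; rewrite subr_eq0 lt_eqF.
Qed.

(** Each tangent passes below the graph, hence below the other tangent at the
    tangency point of the latter; so they meet strictly in between. *)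
Lemma tangent_cross_between p a b : 1 < p -> 0 <= a -> a < b ->
  a < tangent_cross p a b < b.
Proof.
move=> p1 a0 ab; have b0 : 0 <= b by lra.
have D0 : 0 < tangent_slope p b - tangent_slope p a by rewrite subr_gt0 slope_lt.
have ba := tangent_lt_powR p1 a0 b0 (negbT (lt_eqF ab)).
have ba' := tangent_lt_powR p1 b0 a0 (negbT (gt_eqF ab)).
have ea := tangent_sub a p1 a0 ab; have eb := tangent_sub b p1 a0 ab.
apply/andP; split.
  rewrite -subr_gt0 -(pmulr_rgt0 _ D0) -ea /tangent_icept /tangent_slope; lra.
rewrite -subr_lt0 -(pmulr_rlt0 _ D0) -eb /tangent_icept /tangent_slope; lra.
Qed.
End TangentLines.

(** At the left end of its segment [pl_interp] evaluates the previous segment; the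
    two agree there because they share that vertex. *)
Lemma pl_interp_line (R : realType) (pts : seq (R * R)) (i : nat) (a b x : R) :
  sorted (fun P Q => P.1 < Q.1) pts -> (i.+1 < size pts)%N ->
  (nth (0, 0) pts i).2 = a + b * (nth (0, 0) pts i).1 ->
  (nth (0, 0) pts i.+1).2 = a + b * (nth (0, 0) pts i.+1).1 ->
  (nth (0, 0) pts i).1 <= x <= (nth (0, 0) pts i.+1).1 ->
  pl_interp pts x = a + b * x.
Proof.
have lt_trans_fst : transitive (fun P Q : R * R => P.1 < Q.1).
  by move=> ? ? ?; exact: lt_trans.
elim: pts i => [|P [|Q pts] IH] [|i]//.
  move=> /andP[/= PQ _] _ eP eQ /andP[_ ->]; rewrite eP eQ; field.
  by rewrite subr_eq0 gt_eqF.
move=> /andP[/= PQ srtQ] isz ei ei1 xi.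
rewrite -(IH i srtQ isz ei ei1 xi) /=; case: ifPn => // xQ.
have /(order_path_min lt_trans_fst)/allP Qmin := srtQ.
have {IH} i0 : i = 0%N.
  case: i isz xi {ei ei1} => // i isz /andP[xi _].
  have := Qmin _ (mem_nth (0, 0) (ltnW isz)).
  by rewrite ltNge (le_trans xi).
move: isz ei ei1 xi; rewrite {}i0 /= => isz ei ei1 /andP[Qx xi1].
have -> : x = Q.1 by apply/eqP; rewrite eq_le xQ Qx.
rewrite mulfVK; last by rewrite subr_eq0 gt_eqF.
rewrite subrKC; case: pts isz ei1 {Qmin xi1} srtQ => //= Q' pts _ _ /andP[QQ' _].
by rewrite (ltW QQ') subrr mulr0 addr0.
Qed.

(** * The envelope of the tangents at the knots *)

Section TangentEnvelope.
Context {R : realType}.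
Variables (p : R) (n : nat) (xi : nat -> R).

(** The abscissae of the vertices of the envelope of the tangents at the knots
    [xi 0, ..., xi n]: the two extreme knots and the crossings in between.
    The tangent at [xi i] is used between the breakpoints [i] and [i.+1]. *)
Definition breakpoint (i : nat) : R :=
  if i is k.+1 then
    if (k < n)%N then tangent_cross p (xi k) (xi k.+1) else xi n
  else xi 0%N.

Notation icept i := (tangent_icept p (xi i)).
Notation slope i := (tangent_slope p (xi i)).
Notation line i x := (icept i + slope i * x).

Hypothesis p_gt1 : 1 < p.
Hypothesis n_gt0 : (0 < n)%N.
Hypothesis xi0_ge0 : 0 <= xi 0%N.
Hypothesis xi_lt : forall i, (i < n)%N -> xi i < xi i.+1.

Lemma knot_le i j : (i <= j)%N -> (j <= n)%N -> xi i <= xi j.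
Proof.
elim: j => [|j IHj]; first by rewrite leqn0 => /eqP ->.
rewrite leq_eqVlt => /predU1P[-> //|]; rewrite ltnS => ij jn.
by rewrite (le_trans (IHj ij (ltnW jn)))// ltW// xi_lt.
Qed.

Lemma knot_ge0 i : (i <= n)%N -> 0 <= xi i.
Proof. by move=> ilen; rewrite (le_trans xi0_ge0)// knot_le. Qed.

Lemma line_knot i : line i (xi i) = xi i `^ p.
Proof. by rewrite /tangent_icept /tangent_slope subrK. Qed.

Lemma line_le_powR i x : (i <= n)%N -> 0 <= x -> line i x <= x `^ p.
Proof.
move=> ilen x0; have [->|ix] := eqVneq x (xi i); first by rewrite line_knot.
rewrite eq_sym in ix; have := tangent_lt_powR p_gt1 (knot_ge0 ilen) x0 ix.
by rewrite /tangent_icept /tangent_slope; lra.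
Qed.

Lemma line_sub i x : (i < n)%N ->
  line i x - line i.+1 x = (slope i.+1 - slope i) * (breakpoint i.+1 - x).
Proof.
move=> iltn; rewrite /breakpoint iltn.
exact: tangent_sub (knot_ge0 (ltnW iltn)) (xi_lt iltn).
Qed.

Lemma slope_succ i : (i < n)%N -> 0 < slope i.+1 - slope i.
Proof.
move=> iltn; rewrite subr_gt0.
exact: slope_lt (knot_ge0 (ltnW iltn)) (xi_lt iltn).
Qed.

Lemma breakpoint_between i : (i < n)%N -> xi i < breakpoint i.+1 < xi i.+1.
Proof.
move=> iltn; rewrite /breakpoint iltn.
exact: tangent_cross_between (knot_ge0 (ltnW iltn)) (xi_lt iltn).
Qed.

Lemma breakpoint_last : breakpoint n.+1 = xi n.
Proof. by rewrite /breakpoint ltnn. Qed.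

Lemma breakpoint_lt i : (i <= n)%N -> breakpoint i < breakpoint i.+1.
Proof.
move=> ilen; have left_of : breakpoint i <= xi i ?= iff (i == 0%N).
  case: i ilen => [|i] iltn; first exact/leif_refl.
  by apply/leifP => /=; have /andP[] := breakpoint_between iltn.
have right_of : xi i <= breakpoint i.+1 ?= iff (i == n).
  apply/leifP; case: eqVneq => [->|ni]; first by rewrite breakpoint_last.
  by have /andP[] : xi i < breakpoint i.+1 < xi i.+1
    by apply: breakpoint_between; rewrite ltn_neqAle ni.
rewrite (lt_leif (leif_trans left_of right_of)).
by case: i {left_of right_of} ilen => // _; rewrite eqxx/= eq_sym -lt0n.
Qed.

(** By [line_sub], consecutive tangents exchange their order exactly at their
    crossing; moving away from index [i] towards [j], all the crossings met lie
    on the same side of [x]. *)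
Lemma line_max i j x : (i <= n)%N -> (j <= n)%N ->
  breakpoint i <= x <= breakpoint i.+1 -> line j x <= line i x.
Proof.
move=> ilen jlen /andP[ix xi1].
have [ji|ij] := leqP j i.
  have /(_ i ji (leqnn i)) : forall k, (j <= k)%N -> (k <= i)%N ->
      line j x <= line k x; last by [].
  elim=> [|k IHk]; first by rewrite leqn0 => /eqP ->.
  rewrite leq_eqVlt => /predU1P[<- //|]; rewrite ltnS => jk ki.
  rewrite (le_trans (IHk jk (ltnW ki)))// -subr_le0 line_sub ?(leq_trans ki)//.
  apply: mulr_ge0_le0; first by rewrite ltW// slope_succ// (leq_trans ki).
  rewrite subr_le0.
  apply: le_trans ix; apply: (subdivision_le (n := n) (w := breakpoint)) => //.
    by move=> ? /breakpoint_lt/ltW.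
  exact: leqW.
have /(_ j (ltnW ij) (leqnn j)) : forall k, (i <= k)%N -> (k <= j)%N ->
    line k x <= line i x; last by [].
elim=> [|k IHk]; first by rewrite leqn0 => /eqP ->.
rewrite leq_eqVlt => /predU1P[<- //|]; rewrite ltnS => ik kj.
have kn := leq_trans kj jlen.
rewrite (le_trans _ (IHk ik (ltnW kj)))// -subr_ge0 line_sub//.
apply: mulr_ge0; first by rewrite ltW// slope_succ.
rewrite subr_ge0.
apply: (le_trans xi1); apply: (subdivision_le (n := n) (w := breakpoint)) => //.
  by move=> ? /breakpoint_lt/ltW.
exact: leqW.
Qed.

Variables (cU mU : R).
Hypothesis upper_left : cU + mU * xi 0%N = xi 0%N `^ p.
Hypothesis upper_right : cU + mU * xi n = xi n `^ p.

Lemma line_le_upper i x : (i <= n)%N -> xi 0%N <= x <= xi n ->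
  line i x <= cU + mU * x.
Proof.
move=> ilen /andP[lx xu].
have el := line_le_powR ilen xi0_ge0.
have eu := line_le_powR ilen (knot_ge0 (leqnn n)).
rewrite -upper_left in el; rewrite -upper_right in eu.
have lu : xi 0%N < xi n by rewrite (lt_le_trans (xi_lt n_gt0))// knot_le.
move: el eu lu lx xu; move: (icept i) (slope i) (xi 0%N) (xi n) => c m l u.
move=> el eu lu lx xu.
have k0 : 0 < u - l by lra.
rewrite -subr_ge0 -(pmulr_rge0 _ k0).
have -> : (u - l) * (cU + mU * x - (c + m * x)) =
  (u - x) * (cU + mU * l - (c + m * l)) + (x - l) * (cU + mU * u - (c + m * u)).
  by ring.
by rewrite addr_ge0// mulr_ge0// subr_ge0.
Qed.

Definition power_primitive x := x `^ (p + 1) / (p + 1).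

(** Comparing each line with the power function expresses its integral between
    consecutive breakpoints by tangent defects plus an increment of
    primitives. The increments telescope, and the defects are regrouped by
    crossing; those at the two extreme knots vanish. *)
Lemma base_area_defects :
  base_area n breakpoint (fun i => icept i) (fun i => slope i) cU mU
  = cU * (xi n - xi 0%N) + mU * (xi n ^+ 2 - xi 0%N ^+ 2) / 2
    - (power_primitive (xi n) - power_primitive (xi 0%N))
    + \sum_(i < n) (tangent_defect p (xi i) (breakpoint i.+1)
                    - tangent_defect p (xi i.+1) (breakpoint i.+1)).
Proof.
(* [B] collects the part of each term that telescopes. *)
pose B x := cU * x + mU * x ^+ 2 / 2 - power_primitive x.
have termE (i : nat) : (cU - icept i) * (breakpoint i.+1 - breakpoint i)
    + (mU - slope i) * (breakpoint i.+1 ^+ 2 - breakpoint i ^+ 2) / 2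
  = (B (breakpoint i.+1) - B (breakpoint i))
    + (tangent_defect p (xi i) (breakpoint i.+1)
       - tangent_defect p (xi i) (breakpoint i)).
  rewrite /B /tangent_defect /tangent_icept /tangent_slope /power_primitive.
  by field; rewrite gt_eqF// addr_gt0// (lt_trans ltr01).
rewrite /base_area; under eq_bigr do rewrite termE.
rewrite big_split/=; congr (_ + _).
  rewrite -(big_mkord xpredT (fun i => B (breakpoint i.+1) - B (breakpoint i))).
  by rewrite (telescope_sumr (B \o breakpoint))//= ltnn /B; ring.
have defect0 a : tangent_defect p a a = 0 by rewrite /tangent_defect subrr; ring.
move: (@tangent_defect R p) defect0 => K K0.
rewrite !sumrB big_ord_recr/= ltnn K0 addr0.
by rewrite [X in _ - X = _]big_ord_recl/= K0 add0r.
Qed.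
End TangentEnvelope.

(** * The relaxation as a pyramid *)

Lemma locate_subdivision (R : realType) (w : nat -> R) (k : nat) (x : R) :
  w 0%N <= x <= w k.+1 -> exists2 i, (i <= k)%N & w i <= x <= w i.+1.
Proof.
elim: k => [|k IHk] /andP[w0x xw]; first by exists 0%N; rewrite ?w0x.
have [xk|kx] := leP x (w k.+1); last by exists k.+1; rewrite ?(ltW kx).
by have [|i ik wi] := IHk; [rewrite w0x|exists i => //; exact: leqW].
Qed.

Section RelaxationVolume.
Context {R : realType}.
Variables (p l u : R) (n : nat) (v : 'rV[R]_n.-1).

Notation xi := (fun i => (knots l u v)`_i).

Hypothesis n_gt0 : (0 < n)%N.

Lemma size_knots : size (knots l u v) = n.+1.
Proof. by rewrite /= size_rcons size_map size_enum_ord prednK. Qed.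

Lemma knot_last : xi n = u.
Proof.
by have := nth_last 0 (knots l u v); rewrite size_knots /knots/= last_rcons.
Qed.

Lemma knot_inner (j : 'I_n.-1) : xi j.+1 = v 0 j.
Proof.
rewrite /knots /= nth_rcons size_map size_enum_ord ltn_ord.
by rewrite (nth_map j) ?size_enum_ord// nth_ord_enum.
Qed.

Hypothesis l_ge0 : 0 <= l.
Hypothesis p_gt1 : 1 < p.
Hypothesis sorted_knots : sorted <%R (knots l u v).

Lemma knot_lt i : (i < n)%N -> xi i < xi i.+1.
Proof. by move=> iltn; apply: (sortedP 0 sorted_knots); rewrite size_knots. Qed.

Let bp := (breakpoint p n xi).
Notation icept i := (tangent_icept p (xi i)).
Notation slope i := (tangent_slope p (xi i)).
Notation line i x := (icept i + slope i * x).

Lemma knot_itv i : (i <= n)%N -> l <= xi i <= u.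
Proof.
move=> ilen; apply/andP; split; first exact: (knot_le knot_lt (leq0n i)).
by rewrite -[leRHS]knot_last; exact: (knot_le knot_lt).
Qed.

Lemma knots_ends_lt : l < u.
Proof.
rewrite -[ltRHS]knot_last; apply: (lt_le_trans (knot_lt n_gt0)).
exact: (knot_le knot_lt).
Qed.

Lemma derive_knot i : (i <= n)%N ->
  derive_within `[l, u] (fun x => x `^ p) (xi i) = slope i.
Proof. by move=> ilen; rewrite derive_within_powR ?knots_ends_lt ?knot_itv. Qed.

Lemma tangent_abscissaE i : (i < n)%N ->
  tangent_abscissa p l u v i.+1 = bp i.+1.
Proof.
move=> iltn; rewrite /bp /breakpoint iltn /tangent_abscissa -[i.+1.-1]/i !derive_knot//.
exact: ltnW.
Qed.

Notation pts := (pl_vertices p l u v).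

Lemma size_vertices : size pts = n.+2.
Proof. by rewrite /= size_rcons size_map size_iota. Qed.

Lemma vertex0 : nth (0, 0) pts 0 = (bp 0, line 0 (bp 0)).
Proof. by rewrite /bp /= (line_knot p xi 0). Qed.

Lemma vertex_inner i : (i < n)%N ->
  nth (0, 0) pts i.+1 = (bp i.+1, line i.+1 (bp i.+1)).
Proof.
move=> iltn; rewrite /pl_vertices /= nth_rcons size_map size_iota iltn.
rewrite (nth_map 0%N) ?size_iota// nth_iota// add1n tangent_abscissaE//.
by rewrite derive_knot// /tangent_icept /tangent_slope /= iltn; congr (_, _); ring.
Qed.

Lemma vertex_last : nth (0, 0) pts n.+1 = (bp n.+1, line n (bp n.+1)).
Proof.
rewrite /bp breakpoint_last (line_knot p xi n) knot_last.
by rewrite /pl_vertices /= nth_rcons size_map size_iota ltnn eqxx.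
Qed.

Lemma line_meet i : (i < n)%N -> line i (bp i.+1) = line i.+1 (bp i.+1).
Proof.
move=> iltn; apply/eqP; rewrite -subr_eq0.
by rewrite (line_sub p_gt1 l_ge0 knot_lt)// subrr mulr0.
Qed.

Lemma vertex_left i : (i <= n)%N ->
  nth (0, 0) pts i = (bp i, line i (bp i)).
Proof. by case: i => [_|i iltn]; [exact: vertex0|exact: vertex_inner]. Qed.

Lemma vertex_right i : (i <= n)%N ->
  nth (0, 0) pts i.+1 = (bp i.+1, line i (bp i.+1)).
Proof.
rewrite leq_eqVlt => /predU1P[->|iltn]; first exact: vertex_last.
by rewrite vertex_inner// line_meet.
Qed.

Lemma pl_under_line i x : (i <= n)%N -> bp i <= x <= bp i.+1 ->
  pl_under p l u v x = line i x.
Proof.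
move=> ilen xi_; apply: (pl_interp_line (i := i)).
- apply/(sortedP (0, 0)) => j; rewrite size_vertices ltnS ltnS => jlen.
  rewrite vertex_left// vertex_right//=.
  exact: breakpoint_lt p_gt1 n_gt0 l_ge0 knot_lt _ jlen.
- by rewrite size_vertices.
- by rewrite vertex_left.
- by rewrite vertex_right.
- by rewrite vertex_left// vertex_right.
Qed.

Let sl := secant_slope p l u.
Let pyr := (pyramid n bp (fun i => icept i) (fun i => slope i) (l `^ p - sl * l) sl).

Lemma secant_left : l `^ p - sl * l + sl * l = l `^ p.
Proof. by rewrite subrK. Qed.

Lemma secant_right : l `^ p - sl * l + sl * u = u `^ p.
Proof.
rewrite /sl /secant_slope; field; by rewrite subr_eq0 gt_eqF// knots_ends_lt.
Qed.

Lemma bp_max i j x : (i <= n)%N -> (j <= n)%N ->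
  bp i <= x <= bp i.+1 -> line j x <= line i x.
Proof. exact: (line_max p_gt1 n_gt0 l_ge0 knot_lt). Qed.

Lemma bp_last : bp n.+1 = u.
Proof. by rewrite /bp breakpoint_last knot_last. Qed.

(** On its domain the interpolant is the largest of the tangents, so the condition
    [z g(x / z) <= y] splits into linear inequalities. Nonnegativity of [y]
    follows from the tangent at [l], which is nonnegative on the whole segment. *)
Lemma generatorsE : U_generators p l u v = pyr `&` [set q | 0 < q.2].
Proof.
have under_le (x y z : R) : 0 < z -> l * z <= x <= u * z ->
    (z * pl_under p l u v (x / z) <= y) <->
    (forall i, (i <= n)%N -> icept i * z + slope i * x <= y).
  move=> z0 xz.
  have xz' : bp 0%N <= x / z <= bp n.+1.
    by rewrite bp_last ler_pdivlMr// ler_pdivrMr.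
  have [i ilen xi_] := locate_subdivision xz'.
  have lineE j : z * line j (x / z) = icept j * z + slope j * x.
    by field; rewrite gt_eqF.
  rewrite (pl_under_line ilen xi_) lineE; split; last exact.
  move=> iy j jlen; apply: le_trans iy.
  by rewrite -!lineE ler_pM2l// bp_max.
apply/seteqP; split=> -[[x y] z]; rewrite /setI /pyr /pyramid bp_last /=.
  case=> yU yL xz /andP[z0 z1] _; split => //; split => //; first by rewrite ltW.
  exact/under_le.
case=> -[/andP[_ z1] xz lines yU] z0; split => //.
- exact/under_le.
- by rewrite z0.
- apply: le_trans (lines 0%N _) => //.
  have slope0 : 0 <= slope 0%N by rewrite mulr_ge0 ?powR_ge0// ltW// (lt_trans ltr01).
  have -> : icept 0%N * z + slope 0%N * x = l `^ p * z + slope 0%N * (x - l * z).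
    by rewrite -(line_knot p xi 0) /=; ring.
  have /andP[lzx _] := xz.
  apply: addr_ge0; apply: mulr_ge0 => //; [exact: powR_ge0|exact: ltW|].
  by rewrite subr_ge0.
Qed.

(** All the inequalities are homogeneous, except [z <= 1]. Taking [b = 0] also
    shows that the pyramid can be shrunk towards its apex. *)
Lemma pyramid_conic (a b : R) (q q' : R * R * R) : 0 <= a -> 0 <= b -> a + b <= 1 ->
  pyr q -> pyr q' -> pyr (a *: q + b *: q').
Proof.
case: q => [[x y] z]; case: q' => [[x' y'] z'] a0 b0 ab1.
rewrite /pyr /pyramid /GRing.scale/= /GRing.scale/=.
move=> -[/andP[z0 z1] /andP[xl xu] lines yU] -[/andP[z'0 z'1] /andP[xl' xu'] lines' yU'].
split.
- apply/andP; split; first by rewrite addr_ge0// mulr_ge0.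
  by apply: le_trans ab1; rewrite lerD// ler_piMr.
- have scaleE k : k * (a * z + b * z') = a * (k * z) + b * (k * z') by ring.
  by rewrite !scaleE; apply/andP; split; apply: lerD; exact: ler_wpM2l.
- move=> i ilen.
  apply: le_trans (lerD (ler_wpM2l a0 (lines i ilen)) (ler_wpM2l b0 (lines' i ilen))).
  by rewrite le_eqVlt; apply/orP; left; apply/eqP; ring.
- apply: le_trans (lerD (ler_wpM2l a0 yU) (ler_wpM2l b0 yU')) _.
  by rewrite le_eqVlt; apply/orP; left; apply/eqP; ring.
Qed.

Lemma convex_generators : convex_set (U_generators p l u v).
Proof.
move=> q q' t; rewrite generatorsE !inE => -[Pq zq] [Pq' zq'].
have t0 : 0 <= t%:num by []. have t1 : t%:num <= 1 by [].
split.
  by apply: pyramid_conic => //; rewrite ?subr_ge0// /unstable.onem subrKC.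
rewrite /= /GRing.scale/=; move: t0; rewrite le_eqVlt => /predU1P[<-|t0].
  by rewrite mul0r add0r /unstable.onem subr0 mul1r.
by rewrite ltr_wpDr ?mulr_gt0// mulr_ge0 ?subr_ge0// ltW.
Qed.

Lemma closed_pyramid : closed pyr.
Proof.
have cx : continuous (fun q : R * R * R => q.1.1).
  by move=> q; apply: (@continuous_comp _ _ _ fst fst); exact: cvg_fst.
have cy : continuous (fun q : R * R * R => q.1.2).
  by move=> q; apply: (@continuous_comp _ _ _ fst snd); [exact: cvg_fst|exact: cvg_snd].
have cz : continuous (fun q : R * R * R => q.2) by move=> q; exact: cvg_snd.
have closed_fun_le (f g : R * R * R -> R) : continuous f -> continuous g ->
    closed [set q | f q <= g q].
  move=> cf cg; have -> : [set q | f q <= g q]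
      = (fun q => f q - g q) @^-1` [set x | x <= 0].
    by apply/seteqP; split=> q /=; rewrite subr_le0.
  apply: closed_comp; last exact: closed_le.
  by move=> q _; apply: cvgB; [exact: cf|exact: cg].
have ccst (a : R) : continuous (fun _ : R * R * R => a) by move=> q; exact: cvg_cst.
have cscale a : continuous (fun q : R * R * R => a * q.2).
  by move=> q; apply: cvgMl_tmp; exact: cz.
have clin a b : continuous (fun q : R * R * R => a * q.2 + b * q.1.1).
  by move=> q; apply: cvgD; [exact: cscale|apply: cvgMl_tmp; exact: cx].
have -> : pyr =
    [set q | 0 <= q.2] `&` [set q | q.2 <= 1]
    `&` ([set q | bp 0%N * q.2 <= q.1.1] `&` [set q | q.1.1 <= bp n.+1 * q.2])
    `&` (\bigcap_(i in [set i | (i <= n)%N])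
         [set q | icept i * q.2 + slope i * q.1.1 <= q.1.2])
    `&` [set q | q.1.2 <= (l `^ p - sl * l) * q.2 + sl * q.1.1].
  apply/seteqP; split=> q.
    by case=> /andP[? ?] /andP[? ?] lines ?; split.
  by case=> -[[[z0 z1] [x0 x1]] lines] y1; split => //=; apply/andP; split.
apply: closedI; last exact: closed_fun_le.
apply: closedI; last by apply: closed_bigI => i _; exact: closed_fun_le.
by apply: closedI; apply: closedI; exact: closed_fun_le.
Qed.

Lemma conv_hull_convex (E : lmodType R) (A : set E) : convex_set A -> conv_hull A = A.
Proof.
move=> cA; apply/seteqP; split; last exact: sub_smallest.
by apply: smallest_sub.
Qed.

(** The generators form the pyramid without its apex, which is a convex set; the
    closure adds the apex, as a limit of shrunken points of the base. *)
Lemma U_breveE : U_breve p l u v = pyr.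
Proof.
rewrite /U_breve conv_hull_convex; last exact: convex_generators.
apply/seteqP; split.
  rewrite closureE; apply: smallest_sub; first exact: closed_pyramid.
  by rewrite generatorsE => q [].
move=> q Pq; have [q0|q0] := ltP 0 q.2.
  by apply: subset_closure; rewrite generatorsE.
have -> : q = 0.
  case: q Pq q0 => [[x y] z] /= -[/andP[z0 _] xz lines yU] z_le0.
  have z_eq0 : z = 0 by apply/eqP; rewrite eq_le z0 z_le0.
  move: xz lines yU; rewrite /= z_eq0 !mulr0 => /andP[x0 x1] lines yU.
  have x_eq0 : x = 0 by apply/eqP; rewrite eq_le x0 x1.
  have y0 := lines 0%N isT.
  move: y0 yU; rewrite x_eq0 !mulr0 !addr0 => y0 y1.
  by congr (_, _, _); apply/eqP; rewrite eq_le y0 y1.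
pose top_pt : R * R * R := (l, l `^ p, 1).
have top_ptP : pyr top_pt.
  rewrite /pyr /pyramid /top_pt bp_last /= !mulr1; split.
  - by rewrite ler01 lexx.
  - by rewrite lexx ltW// knots_ends_lt.
  - move=> i ilen; rewrite mulr1.
    exact: (line_le_powR p_gt1 l_ge0 knot_lt).
  - by rewrite secant_left.
have shrink (k : nat) : U_generators p l u v (k.+1%:R^-1 *: top_pt).
  rewrite generatorsE; split; last first.
    by rewrite /top_pt /= /GRing.scale/= mulr1 invr_gt0.
  rewrite -[_ *: _]addr0 -[X in _ + X](scale0r top_pt).
  apply: pyramid_conic => //; rewrite ?invr_ge0// addr0 invf_le1//.
  by rewrite ler1n.
have cvg0 : (k.+1%:R^-1 *: top_pt : R * R * R) @[k --> \oo] --> (0 : R * R * R).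
  have : k.+1%:R^-1 *: top_pt @[k --> \oo] --> (0 : R) *: top_pt.
    by apply: cvgZr_tmp; exact: cvg_harmonic.
  by rewrite scale0r.
move=> B /cvg0 [k _ kB].
by exists (k.+1%:R^-1 *: top_pt); split; [exact: shrink|exact: kB k (leqnn k)].
Qed.
End RelaxationVolume.

(** * Strict convexity of the volume *)

Section Assembly.
Context {R : realType}.
Variables (p l u : R) (n : nat).
Hypotheses (l_ge0 : 0 <= l) (p_gt1 : 1 < p) (n_gt0 : (0 < n)%N).
Implicit Types v : 'rV[R]_n.-1.

Notation knot v := (fun i : nat => (knots l u v)`_i).

(** For [a <= x <= b], the area between the power function and its tangents at [a]
    and [b], the former used up to [x] and the latter from [x] on. *)
Definition piece_defect a b x := tangent_defect p a x - tangent_defect p b x.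

Definition crossing v i := tangent_cross p (knot v i) (knot v i.+1).

(** The area between the secant and the power function, which does not depend on the
    inner knots. *)
Definition trapezoid_excess :=
  let s := secant_slope p l u in
  (l `^ p - s * l) * (u - l) + s * (u ^+ 2 - l ^+ 2) / 2
  - (power_primitive p u - power_primitive p l).

Lemma volume_U_breve v : knot_domain l u v ->
  vol3 (U_breve p l u v)
  = ((trapezoid_excess
      + \sum_(i < n) piece_defect (knot v i) (knot v i.+1) (crossing v i)) / 3)%:E.
Proof.
move=> srt; have kl := knot_lt n_gt0 srt.
rewrite (U_breveE n_gt0 l_ge0 p_gt1 srt) /vol3 volume_pyramid.
- rewrite base_area_defects// knot_last//; congr (_ / _)%:E; congr (_ + _).
  apply: eq_bigr => i _.
  by rewrite /piece_defect /crossing /breakpoint ltn_ord.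
- by move=> i ilen; rewrite ltW// (breakpoint_lt p_gt1 n_gt0 l_ge0 kl).
- exact: (line_max p_gt1 n_gt0 l_ge0 kl).
- move=> i x ilen xi_; apply: (line_le_upper p_gt1 n_gt0 l_ge0 kl) => //.
  + by rewrite /= secant_left.
  + by rewrite knot_last// (secant_right p n_gt0 srt).
  + have bpmono j : (j <= n)%N -> breakpoint p n (knot v) j <= breakpoint p n (knot v) j.+1.
      by move=> jn; rewrite ltW// (breakpoint_lt p_gt1 n_gt0 l_ge0 kl).
    have /andP[xl xr] := xi_; apply/andP; split.
      by apply: le_trans xl; exact: (subdivision_le bpmono (leq0n i) (leqW ilen)).
    apply: (le_trans xr); rewrite -[leRHS](breakpoint_last p n (knot v)).
    exact: (subdivision_le bpmono).
Qed.

(** Both terms of [piece_defect] involve the same primitive of the power function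
    at [x], so their difference is a quadratic polynomial in [x], whose
    derivative, the difference of the two tangents, is increasing and vanishes at
    their crossing. *)
Lemma piece_defect_crossing_min a b x : 0 <= a -> a < b ->
  piece_defect a b (tangent_cross p a b) <= piece_defect a b x.
Proof.
move=> a0 ab; set c := tangent_cross p a b.
have D0 : 0 < tangent_slope p b - tangent_slope p a by rewrite subr_gt0 slope_lt.
have ec : tangent_icept p a + tangent_slope p a * c
   = tangent_icept p b + tangent_slope p b * c.
  by apply/eqP; rewrite -subr_eq0 tangent_sub// subrr mulr0.
rewrite -subr_ge0.
have -> : piece_defect a b x - piece_defect a b c =
    (tangent_slope p b - tangent_slope p a) / 2 * (x - c) ^+ 2
    + (x - c) * ((tangent_icept p b + tangent_slope p b * c)
      - (tangent_icept p a + tangent_slope p a * c)).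
  rewrite /piece_defect /tangent_defect /tangent_icept /tangent_slope; field.
  by rewrite gt_eqF// addr_gt0// (lt_trans ltr01).
by rewrite ec subrr mulr0 addr0 mulr_ge0 ?sqr_ge0// divr_ge0// ltW.
Qed.

Lemma piece_defect_convex t a0 b0 c0 a1 b1 c1 : p <= 2 -> 0 < t < 1 ->
  0 <= a0 -> 0 <= a1 -> a0 < c0 < b0 -> a1 < c1 < b1 ->
  piece_defect (t * a0 + (1 - t) * a1) (t * b0 + (1 - t) * b1)
    (t * c0 + (1 - t) * c1)
  < t * piece_defect a0 b0 c0 + (1 - t) * piece_defect a1 b1 c1
  ?<= if (c0 - a0 == c1 - a1) && (c0 - b0 == c1 - b1).
Proof.
move=> p2 t01 a00 a10 /andP[ac0 cb0] /andP[ac1 cb1].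
have p12 : 1 < p <= 2 by rewrite p_gt1.
have left := @tangent_defect_convex R p 1 t a0 c0 a1 c1 p12 t01 a00 a10.
have right := @tangent_defect_convex R p (-1) t b0 c0 b1 c1 p12 t01.
have {left} : tangent_defect p (t * a0 + (1 - t) * a1) (t * c0 + (1 - t) * c1)
    < t * tangent_defect p a0 c0 + (1 - t) * tangent_defect p a1 c1
    ?<= if (c0 - a0 == c1 - a1).
  by move: left; rewrite !mul1r expr1n !mul1r; apply; lra.
have {right} : - tangent_defect p (t * b0 + (1 - t) * b1) (t * c0 + (1 - t) * c1)
    < - (t * tangent_defect p b0 c0 + (1 - t) * tangent_defect p b1 c1)
    ?<= if (c0 - b0 == c1 - b1).
  by move: right; rewrite !mulN1r exprS sqrrN expr1n mulr1 !mulN1r; apply; lra.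
rewrite /piece_defect; move: (tangent_defect p) => K.
case: (c0 - a0 == c1 - a1); case: (c0 - b0 == c1 - b1) => /= *; lra.
Qed.

End Assembly.

Lemma knots_avg (R : realType) (l u t : R) (n : nat) (v w : 'rV[R]_n.-1) i :
  (0 < n)%N -> (i <= n)%N ->
  (knots l u (t *: v + (1 - t) *: w))`_i
  = t * (knots l u v)`_i + (1 - t) * (knots l u w)`_i.
Proof.
move=> n_gt0; case: i => [_|i]; first by rewrite /=; ring.
rewrite leq_eqVlt => /predU1P[->|]; first by rewrite !knot_last//; ring.
rewrite -[X in (_ < X)%N](prednK n_gt0) ltnS => ilt.
by have := knot_inner l u _ (Ordinal ilt) => /= E; rewrite !E !mxE.
Qed.

Theorem theorem3p5 (R : realType) (l u p : R) (n : nat)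
    (l_ge0 : 0 <= l) (lt_lu : l < u) (p_gt1 : 1 < p) (p_le2 : p <= 2)
    (n_ge2 : (2 <= n)%N) :
  strictly_convex_on (@knot_domain R l u n)
    (fun v : 'rV[R]_n.-1 => vol3 (U_breve p l u v)).
Proof.
have n_gt0 : (0 < n)%N := ltnW n_ge2.
move=> v w t Dv Dw vw /andP[t0 t1].
set m := t *: v + (1 - t) *: w.
pose xi (v : 'rV[R]_n.-1) i := (knots l u v)`_i.
have lt_v i : (i < n)%N -> xi v i < xi v i.+1 by exact: knot_lt.
have lt_w i : (i < n)%N -> xi w i < xi w i.+1 by exact: knot_lt.
have ge0_v i : (i <= n)%N -> 0 <= xi v i by exact: (knot_ge0 (xi := xi v)).
have ge0_w i : (i <= n)%N -> 0 <= xi w i by exact: (knot_ge0 (xi := xi w)).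
have avg i : (i <= n)%N -> xi m i = t * xi v i + (1 - t) * xi w i.
  exact: knots_avg.
have lt_m i : (i < n)%N -> xi m i < xi m i.+1.
  move=> ilt; rewrite !avg ?(ltnW ilt)//.
  by rewrite ltrD// ltr_pM2l ?subr_gt0// ?lt_v ?lt_w.
have Dm : knot_domain l u m.
  apply/(sortedP 0) => i; rewrite size_knots// ltnS => ilt; exact: lt_m.
rewrite !volume_U_breve// -!EFinM -EFinD lte_fin.
set C := trapezoid_excess p l u.
pose S v := \sum_(i < n) piece_defect p (xi v i) (xi v i.+1) (crossing p l u v i).
rewrite -/(S v) -/(S w) -/(S m).
suff : S m < t * S v + (1 - t) * S w by lra.
(* The averaged crossings are a competitor for the minimum over break points
   at the averaged knots. *)
pose c i := t * crossing p l u v i + (1 - t) * crossing p l u w i.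
pose gap (i : 'I_n) := t * piece_defect p (xi v i) (xi v i.+1) (crossing p l u v i)
  + (1 - t) * piece_defect p (xi w i) (xi w i.+1) (crossing p l u w i)
  - piece_defect p (xi m i) (xi m i.+1) (crossing p l u m i).
pose same (i : nat) := (crossing p l u v i - xi v i == crossing p l u w i - xi w i)
  && (crossing p l u v i - xi v i.+1 == crossing p l u w i - xi w i.+1).
have gapP (i : 'I_n) : 0 < gap i ?<= if same i.
  have iltn := ltn_ord i; have ilen := ltnW iltn.
  rewrite subr_lteif0r.
  have cv : xi v i < crossing p l u v i < xi v i.+1.
    by apply: tangent_cross_between => //; [exact: ge0_v|exact: lt_v].
  have cw : xi w i < crossing p l u w i < xi w i.+1.
    by apply: tangent_cross_between => //; [exact: ge0_w|exact: lt_w].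
  have t01 : 0 < t < 1 by rewrite t0.
  have convex := piece_defect_convex p_gt1 p_le2 t01 (ge0_v i ilen)
    (ge0_w i ilen) cv cw.
  rewrite -!avg// in convex.
  have min : piece_defect p (xi m i) (xi m i.+1) (crossing p l u m i)
      <= piece_defect p (xi m i) (xi m i.+1) (c i).
    apply: piece_defect_crossing_min => //; last exact: lt_m.
    by rewrite avg// addr_ge0// mulr_ge0 ?ge0_v ?ge0_w ?subr_ge0// ltW.
  exact: (@lteif_trans _ _ _ _ _ true _ min convex).
have gap_ge0 (i : 'I_n) : 0 <= gap i := lteifW (gapP i).
have SE : t * S v + (1 - t) * S w - S m = \sum_(i < n) gap i.
  by rewrite /S !mulr_sumr -big_split -sumrB.
rewrite -subr_gt0 SE lt0r sumr_ge0 ?andbT//.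
(* Without strictness every gap vanishes, so the knots of [v] and [w] have the
   same distances to their neighbouring crossings; starting from the common
   knot [l], they all coincide. *)
apply: contra_neqN vw => /eqP/psumr_eq0P gap0.
have same_all (i : 'I_n) : same i.
  have := gapP i; rewrite gap0//; case: (same i) => //=.
  by rewrite ltxx.
have knots_eq i : (i <= n)%N -> xi v i = xi w i.
  elim: i => [//|i IHi] iltn.
  have /andP[/eqP e1 /eqP e2] := same_all (Ordinal iltn).
  have := IHi (ltnW iltn); rewrite /= in e1 e2; lra.
apply/rowP => j; rewrite -(knot_inner l u v) -(knot_inner l u w).
by apply: knots_eq; rewrite (leq_trans (ltn_ord j))// leq_pred.
Qed.
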